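(* Let $\mathcal{P}=(\mathcal{P},d,\mu)$ be a metric measure space, and assume that there are $L^\infty$-almost no nonconstant rectifiable curves in $\mathcal{P}$. Then the following are equivalent: (a) $L^\infty(\mathcal{P})$ has the Vitali--Carathéodory property. (b) The Sobolev capacity $C_\infty$ is an outer capacity. (c) $C_\infty(E)=1$ for every nonempty set $E\subset\mathcal{P}$. (d) $\mu(\{x\})>0$ for every $x\in\mathcal{P}$.
   Context: Standing assumption: a metric measure space $\mathcal{P}=(\mathcal{P},d,\mu)$ is a metric space equipped with a positive complete Borel measure $\mu$ such that $0<\mu(B)<\infty$ for every ball $B\subset\mathcal{P}$. $\mathcal{P}$ has $L^\infty$-almost no nonconstant rectifiable curves if there is a Borel function $\rho:\mathcal{P}\to[0,\infty]$ with $\rho\in L^\infty(\mathcal{P})$ such that $\int_\gamma\rho\,ds=\infty$ for every nonconstant rectifiable curve $\gamma$ in $\mathcal{P}$. Upper gradients: a Borel function $g:\mathcal{P}\to[0,\infty]$ is an upper gradient of $u:\mathcal{P}\to[-\infty,\infty]$ if $|u(\gamma(0))-u(\gamma(l_\gamma))|\le\int_\gamma g\,ds$ for every nonconstant rectifiable curve $\gamma:[0,l_\gamma]\to\mathcal{P}$ (parametrized by arc length, $l_\gamma$ being its length), with the convention $|(\pm\infty)-(\pm\infty)|=\infty$. Newtonian space: $N^{1,\infty}(\mathcal{P})$ is the set of all $u\in L^\infty(\mathcal{P})$ with $\|u\|_{N^{1,\infty}(\mathcal{P})}:=\|u\|_{L^\infty(\mathcal{P})}+\inf_g\|g\|_{L^\infty(\mathcal{P})}<\infty$,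 where the infimum is over all upper gradients $g$ of $u$. Functions in $N^{1,\infty}(\mathcal{P})$ are defined everywhere on $\mathcal{P}$ with values in $[-\infty,\infty]$ (not just up to a.e. equivalence). Capacity: for $E\subset\mathcal{P}$, $C_\infty(E)=\inf\{\|u\|_{N^{1,\infty}(\mathcal{P})}: u\ge 1\text{ on }E\}$ (infimum over $u\in N^{1,\infty}(\mathcal{P})$). $C_\infty$ is an outer capacity if $C_\infty(E)=\inf\{C_\infty(G): G\text{ open},\ G\supset E\}$ for every set $E\subset\mathcal{P}$. Vitali--Carathéodory property: $L^\infty(\mathcal{P})$ has the Vitali--Carathéodory property if for every measurable function $u:\mathcal{P}\to[-\infty,\infty]$, $\|u\|_{L^\infty(\mathcal{P})}=\inf\{\|v\|_{L^\infty(\mathcal{P})}: v\ge|u|\text{ on }\mathcal{P}\text{ and }v\text{ is lower semicontinuous on }\mathcal{P}\}$, where inequalities are pointwise everywhere. *)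

(* Defs.v *)
From HB Require Import structures.
From mathcomp Require Import all_boot all_order all_algebra.
From mathcomp Require Import all_classical all_reals all_analysis.
From mathcomp Require Import measurable_realfun.

Set Implicit Arguments.
Unset Strict Implicit.
Unset Printing Implicit Defensive.

Import Order.TTheory GRing.Theory Num.Theory.
Import numFieldNormedType.Exports.

Local Open Scope classical_set_scope.
Local Open Scope ring_scope.
Local Open Scope ereal_scope.

(* A type carrying both a distance and a sigma-algebra; the two are related
   only through [metric_measure_space] below. *)
#[short(type="metricMeasurableType")]
HB.structure Definition MetricMeasurable (K : numDomainType)
  (d : measure_display) := {T of Metric K T & Measurable d T}.

(* "Complete Borel measure": the domain of mu is a sigma-algebra that contains
   the Borel sets (it may be larger) and every subset of a mu-null set. *)
Definition metric_measure_space (R : realType) (d : measure_display)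
    (P : metricMeasurableType R d) (mu : {measure set P -> \bar R}) : Prop :=
  [/\ <<s @open P >> `<=` @measurable d P,
      measure_is_complete mu &
      forall (x : P) (r : R), (0 < r)%R -> 0 < mu (ball x r) < +oo].

Definition borel_fun (R : realType) (d : measure_display)
    (P : metricMeasurableType R d) (g : P -> \bar R) : Prop :=
  measurable_fun [set: g_sigma_algebraType (@open P)]
    (g : g_sigma_algebraType (@open P) -> \bar R).

Definition curve_length (R : realType) (P : metricType R) (a b : R)
    (c : R -> P) : \bar R :=
  ereal_sup [set (\sum_(0 <= n < size s)
                    mdist (c (nth b (a :: s) n)) (c (nth b (a :: s) n.+1)))%:E
            | s in itv_partition a b].

(* A curve is a continuous map on a compact interval [a, b]; the values of c
   outside [a, b] are irrelevant. *)
Definition rectifiable_curve (R : realType) (P : metricType R) (a b : R)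
    (c : R -> P) : Prop :=
  [/\ (a <= b)%R, {within `[a, b], continuous c} & curve_length a b c < +oo].

Definition nonconstant_curve (R : realType) (P : metricType R) (a b : R)
    (c : R -> P) : Prop :=
  exists2 t, t \in `[a, b] & c t <> c a.

(* The arc length parametrization c~ : [0, l] -> P of c, characterized by
   c~ (curve_length a t c) = c t for t in [a, b]. The choice of t is immaterial:
   c is constant between two parameters with the same arc length. *)
Definition arclength_param (R : realType) (P : metricType R) (a b : R)
    (c : R -> P) (s : R) : P :=
  c (xget a [set t | t \in `[a, b] /\ curve_length a t c = s%:E]).

Definition line_integral (R : realType) (P : metricType R) (a b : R)
    (c : R -> P) (g : P -> \bar R) : \bar R :=
  \int[lebesgue_measure]_(s in `[0%R, fine (curve_length a b c)])
    g (arclength_param a b c s).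

Definition no_nonconstant_rectifiable_curves (R : realType)
    (d : measure_display) (P : metricMeasurableType R d)
    (mu : {measure set P -> \bar R}) : Prop :=
  exists rho : P -> \bar R,
    [/\ borel_fun rho, (forall x, 0 <= rho x), 'N[mu]_+oo [rho] < +oo &
        forall (a b : R) (c : R -> P),
          rectifiable_curve a b c -> nonconstant_curve a b c ->
          line_integral a b c rho = +oo].

(* In \bar R one has +oo - +oo = -oo + +oo = -oo, so `|x - x| = +oo for
   infinite x, which is the convention required here. *)
Definition upper_gradient (R : realType) (d : measure_display)
    (P : metricMeasurableType R d) (u g : P -> \bar R) : Prop :=
  [/\ borel_fun g, (forall x, 0 <= g x) &
      forall (a b : R) (c : R -> P),
        rectifiable_curve a b c -> nonconstant_curve a b c ->
        `|u (c a) - u (c b)| <= line_integral a b c g].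

Definition newton_norm (R : realType) (d : measure_display)
    (P : metricMeasurableType R d) (mu : {measure set P -> \bar R})
    (u : P -> \bar R) : \bar R :=
  'N[mu]_+oo [u] + ereal_inf [set 'N[mu]_+oo [g] | g in upper_gradient u].

Definition newton_space (R : realType) (d : measure_display)
    (P : metricMeasurableType R d) (mu : {measure set P -> \bar R}) :
    set (P -> \bar R) :=
  [set u | [/\ measurable_fun [set: P] u, 'N[mu]_+oo [u] < +oo &
               newton_norm mu u < +oo]].

Definition sobolev_capacity (R : realType) (d : measure_display)
    (P : metricMeasurableType R d) (mu : {measure set P -> \bar R})
    (E : set P) : \bar R :=
  ereal_inf [set newton_norm mu u
            | u in [set u | newton_space mu u /\ forall x, E x -> 1 <= u x]].

Definition outer_capacity (R : realType) (P : topologicalType)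
    (C : set P -> \bar R) : Prop :=
  forall E : set P,
    C E = ereal_inf [set C G | G in [set G | open G /\ E `<=` G]].

Definition vitali_caratheodory (R : realType) (d : measure_display)
    (P : metricMeasurableType R d) (mu : {measure set P -> \bar R}) : Prop :=
  forall u : P -> \bar R, measurable_fun [set: P] u ->
    'N[mu]_+oo [u] =
    ereal_inf [set 'N[mu]_+oo [v]
              | v in [set v | (forall x, `|u x| <= v x) /\
                              lower_semicontinuous v]].

(* Main.v *)
Require Import Defs.
From HB Require Import structures.
From mathcomp Require Import all_boot all_order all_algebra.
From mathcomp Require Import all_classical all_reals all_analysis.
From mathcomp Require Import measurable_realfun ess_sup_inf.

Import Order.TTheory GRing.Theory Num.Theory.
Import numFieldNormedType.Exports.

Local Open Scope classical_set_scope.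
Local Open Scope ring_scope.
Local Open Scope ereal_scope.

(** Let [rho] be the bounded function of the hypothesis. Every positive multiple
of [rho] is an upper gradient of every function, so the infimum over upper
gradients vanishes and the Newtonian norm is just the [L^oo]-norm. Hence a
point of measure zero has capacity zero, whereas a nonempty open set, having
positive measure, has capacity one; and if [v] is lower semicontinuous with
[1 <= v x], then [v] is close to [1] on a set of positive measure. So both (a)
and (b) exclude points of measure zero. Conversely, if no point is negligible,
the [L^oo]-norm is a pointwise supremum, which gives (a) and (c), and (c)
trivially gives (b). *)

Lemma metric_ball_open {R : realType} {T : metricType R} (x : T) (r : R) :
  open (ball x r).
Proof.
rewrite openE => y; rewrite ballEmdist /= => xy.
rewrite /interior -nbhs_ballE; exists (r - mdist x y)%R => /=.
  by rewrite subr_gt0.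
move=> z; rewrite ballEmdist /= ltrBrDl => yz.
by apply: le_lt_trans yz; exact: metric_triangle.
Qed.

Section integral_scale.
Context {d : measure_display} {T : measurableType d} {R : realType}.
Variable mu : {measure set T -> \bar R}.

(* The library version needs [f] measurable; with the integral defined as a
   supremum over simple functions, this half does not. *)
Lemma ge0_le_integralZl (D : set T) (f : T -> \bar R) (k : R) :
  (0 < k)%R -> (forall x, 0 <= f x) ->
  k%:E * \int[mu]_(x in D) f x <= \int[mu]_(x in D) (k%:E * f x).
Proof.
move=> k0 f0.
have k0' : (0 <= k)%R by exact: ltW.
rewrite -lee_pdivlMl// !ge0_integralE//; last by move=> x _; rewrite mule_ge0.
apply: ge_ereal_sup => _ [h /= hf <-].
rewrite lee_pdivlMl// -sintegralrM.
apply: ereal_sup_ubound; exists (scale_nnsfun h k0') => //= x.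
rewrite EFinM; have := hf x; rewrite /patch.
(* On [D] the positive factor [k] cancels. Off [D] the patched function is 0, so [h x <= 0], which
   scaling by [k] preserves. *)
by case: ifPn => _ hx; [rewrite lee_pmul2l|rewrite pmule_rle0].
Qed.

End integral_scale.

(** * The essential supremum norm *)

Section Linfty.
Context {d : measure_display} {T : measurableType d} {R : realType}.
Variable mu : {measure set T -> \bar R}.
Implicit Types (f g : T -> \bar R) (M c : \bar R).

(** The norm is the essential supremum if [mu] is nonzero, and 0 by convention if the whole space is
    null; [0 <= M] covers the latter case. *)
Lemma Lnormy_le f M : 0 <= M -> (\forall x \ae mu, `|f x| <= M) ->
  'N[mu]_+oo [f] <= M.
Proof.
by move=> M0 fM; rewrite unlock; case: ifPn => // _; exact/ess_supP.
Qed.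

Lemma ae_le_Lnormy f : \forall x \ae mu, `|f x| <= 'N[mu]_+oo [f].
Proof.
rewrite unlock; case: ifPn => [_|]; first exact: (ess_sup_ge mu (abse \o f)).
(* If the whole space is null, it serves as the exceptional set. *)
rewrite lt0e measure_ge0 andbT negbK => /eqP muT.
by exists setT; split.
Qed.

Lemma le_Lnormy f g : (forall x, `|f x| <= `|g x|) ->
  'N[mu]_+oo [f] <= 'N[mu]_+oo [g].
Proof.
move=> fg; rewrite unlock; case: ifPn => // _.
by apply: le_ess_sup; exact: nearW.
Qed.

(** Were the norm below [c], the null set off which it bounds [f] would contain [S]. *)
Lemma Lnormy_ge f (S : set T) c : measurable S -> 0 < mu S ->
  (forall x, S x -> c <= `|f x|) -> c <= 'N[mu]_+oo [f].
Proof.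
move=> mS muS cf.
rewrite leNgt; apply/negP => fc.
have [N [mN muN /= sub]] := ae_le_Lnormy f.
have : mu S <= mu N.
  apply: le_measure; rewrite ?inE// => x Sx; apply: sub => /= le_f.
  by have := le_lt_trans (le_trans (cf x Sx) le_f) fc; rewrite ltxx.
by rewrite muN leNgt muS.
Qed.

End Linfty.

(** * Newtonian norm and capacity without nonconstant rectifiable curves *)

Section capacity.
Context {R : realType} {d : measure_display} {P : metricMeasurableType R d}.
Variable mu : {measure set P -> \bar R}.
Hypothesis hP : metric_measure_space mu.
Hypothesis hcurves : no_nonconstant_rectifiable_curves mu.

Lemma open_measurable_mms (G : set P) : open G -> measurable G.
Proof. by case: hP => + _ _ => sub oG; apply: sub; exact: sub_gen_smallest. Qed.

Lemma measurable_set1_mms (x : P) : measurable [set x].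
Proof.
rewrite -[X in measurable X]setCK; apply: measurableC.
apply: open_measurable_mms; rewrite openC.
by apply: accessible_closed_set1; apply: hausdorff_accessible;
  exact: metric_hausdorff.
Qed.

Lemma open_measure_gt0 (G : set P) : open G -> G !=set0 -> 0 < mu G.
Proof.
move=> oG [x Gx]; have := oG; rewrite openE => /(_ x Gx) /=.
rewrite /interior -nbhs_ballE => -[r /= r0 rG].
case: hP => _ _ /(_ x r r0) /andP[+ _] => /lt_le_trans; apply.
apply: le_measure => //; rewrite inE; last exact: open_measurable_mms.
by apply: open_measurable_mms; exact: metric_ball_open.
Qed.

Lemma newton_normE (u : P -> \bar R) : newton_norm mu u = 'N[mu]_+oo [u].
Proof.
rewrite /newton_norm.
suff -> : ereal_inf [set 'N[mu]_+oo [g] | g in upper_gradient u] = 0.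
  by rewrite adde0.
apply/eqP; rewrite eq_le; apply/andP; split; last first.
  by apply: le_ereal_inf_tmp => _ [g _ <-]; exact: Lnorm_ge0.
case: hcurves => rho [mrho rho0 rhoy rhooo].
apply/lee_addgt0Pr => e e0; rewrite add0e.
set r := fine ('N[mu]_+oo [rho]).
have rE : 'N[mu]_+oo [rho] = r%:E by rewrite fineK ?ge0_fin_numE ?Lnorm_ge0.
have r0 : (0 <= r)%R by rewrite fine_ge0 ?Lnorm_ge0.
(* This factor brings the norm of [rho] down to at most [e]; the added 1 keeps the denominator
   positive when [r] is 0. *)
have k0 : (0 < e / (r + 1))%R by rewrite divr_gt0// ltr_wpDl.
pose g x := (e / (r + 1))%:E * rho x.
apply: (@le_trans _ _ 'N[mu]_+oo [g]).
  apply: ereal_inf_lbound; exists g => //.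
  split=> [|x|a b c rc nc].
  - exact: measurable_funeM.
  - by rewrite mule_ge0// lee_fin ltW.
  (* The line integral of [g] is infinite because that of [rho] is, so it dominates every difference
     of values of [u], infinite ones included. *)
  - apply: (le_trans (leey _)).
    have <- : (e / (r + 1))%:E * line_integral a b c rho = +oo.
      by rewrite rhooo// gt0_muley// lte_fin.
    by apply: ge0_le_integralZl => // s; exact: rho0.
apply: Lnormy_le; first by rewrite lee_fin ltW.
have := ae_le_Lnormy mu rho; rewrite rE; apply: filterS => x /= xr.
rewrite /g abseM gee0_abs; last by rewrite lee_fin ltW.
apply: (@le_trans _ _ ((e / (r + 1))%:E * r%:E)).
  by rewrite lee_pmul2l.
rewrite -EFinM lee_fin -mulrAC ler_pdivrMr ?ltr_wpDl//.
by rewrite ler_pM2l// lerDl.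
Qed.

Lemma capacity_le (E : set P) (u : P -> \bar R) : measurable_fun setT u ->
  'N[mu]_+oo [u] < +oo -> (forall x, E x -> 1 <= u x) ->
  sobolev_capacity mu E <= 'N[mu]_+oo [u].
Proof.
move=> mu_ uy Eu; rewrite -newton_normE; apply: ereal_inf_lbound.
by exists u => //; split => //; split => //; rewrite newton_normE.
Qed.

Lemma capacity_ge (E : set P) (c : \bar R) :
  (forall u : P -> \bar R, (forall x, E x -> 1 <= u x) ->
    c <= 'N[mu]_+oo [u]) ->
  c <= sobolev_capacity mu E.
Proof.
move=> Ec; apply: le_ereal_inf_tmp => _ [u [_ Eu] <-].
by rewrite newton_normE; exact: Ec.
Qed.

Lemma capacity_mono (E F : set P) : E `<=` F ->
  sobolev_capacity mu E <= sobolev_capacity mu F.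
Proof.
move=> EF; apply: ereal_inf_le_tmp => _ [u [nu Fu] <-]; exists u => //.
by split=> // x /EF /Fu.
Qed.

Lemma capacity_le1 (E : set P) : sobolev_capacity mu E <= 1.
Proof.
have N1 : 'N[mu]_+oo [cst 1] <= 1.
  by apply: Lnormy_le => //; apply: nearW => x /=; rewrite normr1.
apply: le_trans (N1); apply: capacity_le => //.
by apply: (le_lt_trans N1); exact: ltry.
Qed.

Lemma capacity_open_ge1 (G : set P) : open G -> G !=set0 ->
  1 <= sobolev_capacity mu G.
Proof.
move=> oG G0; apply: capacity_ge => u Gu.
apply: (@Lnormy_ge _ _ _ _ _ G).
- exact: open_measurable_mms.
- exact: open_measure_gt0.
- by move=> x /Gu /le_trans; apply; exact: lee_abs.
Qed.

(** * Consequences of a point of measure zero *)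

Lemma Lnormy_indic_null (x : P) : mu [set x] = 0 ->
  'N[mu]_+oo [EFin \o \1_[set x]] = 0.
Proof.
move=> x0; apply/eqP; rewrite eq_le Lnorm_ge0 andbT; apply: Lnormy_le => //.
exists [set x]; split; [exact: measurable_set1_mms|by []|].
move=> y /=; apply: contra_notP => yx.
by rewrite indicE memNset// normr0.
Qed.

Lemma measurable_indic1 (x : P) :
  measurable_fun setT (EFin \o \1_[set x] : P -> \bar R).
Proof.
apply/measurable_EFinP; apply: measurable_indic; exact: measurable_set1_mms.
Qed.

Lemma capacity_null_point (x : P) : mu [set x] = 0 ->
  sobolev_capacity mu [set x] <= 0.
Proof.
move=> /Lnormy_indic_null x0; rewrite -x0; apply: capacity_le => //.
- exact: measurable_indic1.
- by rewrite x0.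
- by move=> _ -> /=; rewrite indicE mem_set.
Qed.

Lemma outer_capacity_point_gt0 : outer_capacity (sobolev_capacity mu) ->
  forall x : P, 0 < mu [set x].
Proof.
move=> oC x; rewrite lt0e measure_ge0 andbT; apply/eqP => x0.
have := capacity_null_point x x0; rewrite oC; apply/negP; rewrite -ltNge.
apply: (@lt_le_trans _ _ 1) => //; apply: le_ereal_inf_tmp => _ [G [oG xG] <-].
by apply: capacity_open_ge1 => //; exists x; exact: xG.
Qed.

Lemma vitali_caratheodory_point_gt0 : vitali_caratheodory mu ->
  forall x : P, 0 < mu [set x].
Proof.
move=> vc x; rewrite lt0e measure_ge0 andbT; apply/eqP => x0.
have := Lnormy_indic_null x x0; rewrite (vc _ (measurable_indic1 x)).
apply/eqP; rewrite gt_eqF//; apply: (@lt_le_trans _ _ 2^-1%:E) => //.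
apply: le_ereal_inf_tmp => _ [v [uv lv] <-].
(* Any level strictly between 0 and 1 would do: the superlevel set of [v] is open and contains [x],
   where [v] is at least 1. *)
have oG := (lower_semicontinuousP v).1 lv 2^-1%R.
apply: (@Lnormy_ge _ _ _ _ _ [set y | 2^-1%:E < v y]).
- exact: open_measurable_mms.
- apply: open_measure_gt0 => //; exists x => /=.
  apply: lt_le_trans (uv x); rewrite /= indicE mem_set//= normr1 lte_fin.
  by rewrite invf_lt1 // ltr1n.
- by move=> y /= /ltW /le_trans; apply; exact: lee_abs.
Qed.

(** * Consequences of positive measure at every point *)

Lemma point_gt0_capacity1 : (forall x : P, 0 < mu [set x]) ->
  forall E : set P, E !=set0 -> sobolev_capacity mu E = 1.
Proof.
move=> mu0 E [x Ex]; apply/eqP; rewrite eq_le capacity_le1/=.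
apply: capacity_ge => u Eu.
apply: (@Lnormy_ge _ _ _ _ _ [set x]) => //; first exact: measurable_set1_mms.
by move=> _ ->; apply: le_trans (lee_abs _); exact: Eu.
Qed.

Lemma capacity1_point_gt0 :
  (forall E : set P, E !=set0 -> sobolev_capacity mu E = 1) ->
  forall x : P, 0 < mu [set x].
Proof.
move=> C1 x; rewrite lt0e measure_ge0 andbT; apply/eqP => x0.
have := capacity_null_point x x0; rewrite C1; last by exists x.
by rewrite lee_fin ler10.
Qed.

Lemma capacity1_outer :
  (forall E : set P, E !=set0 -> sobolev_capacity mu E = 1) ->
  outer_capacity (sobolev_capacity mu).
Proof.
move=> C1 E; apply/eqP; rewrite eq_le; apply/andP; split.
  by apply: le_ereal_inf_tmp => _ [G [_ EG] <-]; exact: capacity_mono.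
(* The empty set is its own open superset; for nonempty [E] the whole space will do, its capacity
   being at most 1. *)
have [->|/set0P E0] := eqVneq E set0.
  by apply: ereal_inf_lbound; exists set0 => //; split => //; exact: open0.
rewrite (C1 _ E0); apply: (@le_trans _ _ (sobolev_capacity mu setT)).
  by apply: ereal_inf_lbound; exists setT => //; split => //; exact: openT.
exact: capacity_le1.
Qed.

Lemma point_gt0_vitali_caratheodory : (forall x : P, 0 < mu [set x]) ->
  vitali_caratheodory mu.
Proof.
move=> mu0 u mu_; apply/eqP; rewrite eq_le; apply/andP; split.
  apply: le_ereal_inf_tmp => _ [v [uv _] <-]; apply: le_Lnormy => x.
  by apply: (le_trans (uv x)); exact: lee_abs.
apply: (@le_trans _ _ 'N[mu]_+oo [cst 'N[mu]_+oo [u]]); last first.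
  apply: Lnormy_le; first exact: Lnorm_ge0.
  by apply: nearW => x /=; rewrite gee0_abs ?Lnorm_ge0.
(* The constant is a lower semicontinuous majorant: as each singleton has positive measure, the norm
   bounds [u] at every point, not just almost everywhere. *)
apply: ereal_inf_lbound; exists (cst 'N[mu]_+oo [u]) => //; split => [x|x a ax].
  apply: (@Lnormy_ge _ _ _ _ _ [set x]) => //; first exact: measurable_set1_mms.
  by move=> _ ->.
by exists setT => //; exact: filterT.
Qed.

End capacity.

Theorem proposition1p4 (R : realType) (d : measure_display)
    (P : metricMeasurableType R d) (mu : {measure set P -> \bar R})
    (hP : metric_measure_space mu)
    (hcurves : no_nonconstant_rectifiable_curves mu) :
  [<-> vitali_caratheodory mu;
       outer_capacity (sobolev_capacity mu);
       forall E : set P, E !=set0 -> sobolev_capacity mu E = 1;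
       forall x : P, 0 < mu [set x]].
Proof.
tfae.
(* The step from (a) to (b) passes through (d) and (c), that from (b) to (c) through (d). *)
- move=> /(vitali_caratheodory_point_gt0 mu hP) mu0.
  by apply: (capacity1_outer mu hcurves); exact: point_gt0_capacity1.
- move=> /(outer_capacity_point_gt0 mu hP hcurves).
  exact: point_gt0_capacity1.
- exact: capacity1_point_gt0.
- exact: point_gt0_vitali_caratheodory.
Qed.
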